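(* Let $\mathcal{V}=\{1,\dots,N\}$ and let $\{A(t)\}_{t\ge 0}$ ($t$ a non-negative integer) be a chain of $N\times N$ stochastic matrices. If $\{A(t)\}$ is ergodic, then $\{A(t)\}$ has the infinite jet-flow property.
   Context: Time $t$ is discrete, $t=0,1,2,\dots$. A stochastic matrix is a row-stochastic matrix (non-negative entries, each row sums to $1$); $A(t)=[a_{ij}(t)]$. Ergodic: for every $t_0\ge0$ the product $A(t)A(t-1)\cdots A(t_0)$ converges, as $t\to\infty$, to a matrix with identical rows. Jets: a jet $J$ in $\mathcal{V}$ is a sequence $\{J(t)\}_{t\ge0}$ of subsets of $\mathcal{V}$; it is proper if $\emptyset\ne J(t)\subsetneq\mathcal{V}$ for all $t\ge0$. $\mathcal{V}\backslash J$ denotes the jet $\{\mathcal{V}\backslash J(t)\}$. For two disjoint jets $J^s,J^k$ (disjoint at each time), $$U(J^s,J^k)=\sum_{t=0}^\infty\Big[\sum_{i\in J^s(t+1)}\sum_{j\in J^k(t)}a_{ij}(t)+\sum_{i\in J^k(t+1)}\sum_{j\in J^s(t)}a_{ij}(t)\Big]\in[0,\infty].$$ The chain has the infinite jet-flow property if $U(J,\mathcal{V}\backslash J)=\infty$ for every proper jet $J$ in $\mathcal{V}$. *)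

(* Defs.v *)
From mathcomp Require Export all_boot all_order all_algebra.
From mathcomp Require Export all_classical all_reals all_analysis.
Export Order.TTheory GRing.Theory Num.Theory.
Export numFieldNormedType.Exports.

#[export] Set Implicit Arguments.
#[export] Unset Strict Implicit.
#[export] Unset Printing Implicit Defensive.

#[global] Open Scope classical_set_scope.
#[global] Open Scope ring_scope.

Definition stochastic (R : realType) (N : nat) (M : 'M[R]_N) : Prop :=
  (forall i j, 0 <= M i j) /\ (forall i, \sum_j M i j = 1).

(* A(t) *m A(t-1) *m ... *m A(t0), the latest factor on the left; it is the
   identity matrix when t < t0, which does not affect limits in t. *)
Definition backward_prod (R : realType) (N : nat) (A : nat -> 'M[R]_N)
    (t0 t : nat) : 'M[R]_N :=
  \big[mulmx/1%:M]_(s <- rev (index_iota t0 t.+1)) A s.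

Definition ergodic (R : realType) (N : nat) (A : nat -> 'M[R]_N) : Prop :=
  forall t0 : nat, exists L : 'M[R]_N,
    (backward_prod A t0 t @[t --> \oo] --> L) /\
    (forall i j, row i L = row j L).

(* The vertex set {1, ..., N} is represented by 'I_N = {0, ..., N-1}. *)
Definition jet (N : nat) : Type := nat -> {set 'I_N}.

Definition proper_jet (N : nat) (J : jet N) : Prop :=
  forall t, J t != finset.set0 /\ J t \proper finset.setT.

Definition jet_compl (N : nat) (J : jet N) : jet N := fun t => (~: J t)%SET.

(* Meaningful for jets that are disjoint at each time. *)
Definition jet_flow (R : realType) (N : nat) (A : nat -> 'M[R]_N)
    (Js Jk : jet N) : \bar R :=
  (\sum_(0 <= t <oo)
     ((\sum_(i in Js t.+1) \sum_(j in Jk t) A t i j)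
      + (\sum_(i in Jk t.+1) \sum_(j in Js t) A t i j))%R%:E)%E.

Definition infinite_jet_flow (R : realType) (N : nat) (A : nat -> 'M[R]_N)
    : Prop :=
  forall J : jet N, proper_jet J -> jet_flow A J (jet_compl J) = +oo%E.

(* Main.v *)
Require Import Defs.
From mathcomp Require Import lra.

(** Suppose that some proper jet [J] has finite flow, and choose [t0] such that
    the flow of [J] from time [t0] on is at most 1/4.  Let the dynamics
    [x(t+1) = A(t) x(t)] start at time [t0] from the indicator vector of
    [J t0].  Each [A(t)] averages, so over the vertices outside [J] the largest
    coordinate of [x] grows at time [t] by at most the weight that the rows of
    [~: J t.+1] put on [J t] (lemma [weighted_mean_le]); hence it never
    exceeds 1/4 ([trajectory_le_influx]).  The same bound for the
    complementary indicator shows that over [J] the coordinates of [x] are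
    always at least 3/4.  Since [J t] and its complement are never empty, [x(t)] always
    has two coordinates at distance at least 1/2.  Ergodicity, however, forces
    all coordinates of [x(t)] to a common limit
    ([ergodic_trajectory_consensus]). *)

(** The state at time [t0 + n] of the dynamics [x(t+1) = A(t) x(t)] started
    from [u] at time [t0]. *)
Fixpoint trajectory (R : realType) (N : nat) (A : nat -> 'M[R]_N) (t0 : nat)
    (u : 'cV[R]_N) (n : nat) : 'cV[R]_N :=
  if n is m.+1 then A (t0 + m)%N *m trajectory A t0 u m else u.

(** The indicator (column) vector of a set of vertices. *)
Definition indicator_cv (R : realType) (N : nat) (S : {set 'I_N}) : 'cV[R]_N :=
  \col_i (i \in S)%:R.

(** The total weight that the members of [K] at time [t+1] give to the
    non-members at time [t]: one of the two halves of the flow between [K] and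
    its complement. *)
Definition influx (R : realType) (N : nat) (A : nat -> 'M[R]_N) (K : jet N)
    (t : nat) : R :=
  \sum_(i in K t.+1) \sum_(j in (~: K t)%SET) A t i j.

Lemma trajectory_backward_prod (R : realType) (N : nat) (A : nat -> 'M[R]_N)
    (t0 : nat) (u : 'cV[R]_N) (n : nat) :
  trajectory A t0 u n.+1 = backward_prod A t0 (t0 + n) *m u.
Proof.
elim: n => [|n IHn].
  by rewrite /= addn0 /backward_prod /index_iota subSnn /= /rev /= big_cons big_nil mulmx1.
rewrite [LHS]/= -/(trajectory A t0 u n.+1) IHn mulmxA; congr (_ *m _).
rewrite /backward_prod /index_iota -!addnS !addKn -[in RHS]addn1 iotaD.
by rewrite rev_cat /= big_cons.
Qed.

(** Weights [M i j] that sum to 1 average values at most [s] on [S] and at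
    most 1 elsewhere: the excess over [s] is at most the weight outside [S]. *)
Lemma weighted_mean_le (R : realType) (N : nat) (M : 'M[R]_N) (x : 'cV[R]_N)
    (S : {set 'I_N}) (s : R) (i : 'I_N) :
  stochastic M -> 0 <= s -> (forall j, x j 0 <= 1) ->
  (forall j, j \in S -> x j 0 <= s) ->
  (M *m x) i 0 <= s + \sum_(j in (~: S)%SET) M i j.
Proof.
move=> [M0 M1] s0 x1 xs; rewrite mxE (bigID (mem S)) /= lerD//.
  apply: (@le_trans _ _ (\sum_(j in S) M i j * s)).
    by apply: ler_sum => j jS; rewrite ler_wpM2l// xs.
  rewrite -mulr_suml ler_piMl// -(M1 i) [leRHS](bigID (mem S)) /=.
  by rewrite lerDl sumr_ge0.
under [leRHS]eq_bigl do rewrite inE.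
by apply: ler_sum => j _; rewrite ler_piMr.
Qed.

Lemma stochastic_mul_le1 (R : realType) (N : nat) (M : 'M[R]_N)
    (x : 'cV[R]_N) (i : 'I_N) :
  stochastic M -> (forall j, x j 0 <= 1) -> (M *m x) i 0 <= 1.
Proof.
move=> [M0 M1] x1; rewrite mxE -(M1 i).
by apply: ler_sum => j _; rewrite ler_piMr.
Qed.

Lemma trajectory_le1 (R : realType) (N : nat) (A : nat -> 'M[R]_N) (t0 : nat)
    (u : 'cV[R]_N) (n : nat) (i : 'I_N) :
  (forall t, stochastic (A t)) -> (forall j, u j 0 <= 1) ->
  trajectory A t0 u n i 0 <= 1.
Proof.
by move=> hA u1; elim: n i => [|n IHn] i //=; apply: stochastic_mul_le1.
Qed.

Lemma trajectoryD (R : realType) (N : nat) (A : nat -> 'M[R]_N) (t0 : nat)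
    (u v : 'cV[R]_N) (n : nat) :
  trajectory A t0 (u + v) n = trajectory A t0 u n + trajectory A t0 v n.
Proof. by elim: n => //= n ->; rewrite mulmxDr. Qed.

Lemma trajectory_const1 (R : realType) (N : nat) (A : nat -> 'M[R]_N)
    (t0 n : nat) :
  (forall t, stochastic (A t)) ->
  trajectory A t0 (const_mx 1) n = const_mx 1.
Proof.
move=> hA; elim: n => //= n ->; apply/matrixP => i j.
rewrite !mxE -[RHS](proj2 (hA (t0 + n)%N) i).
by apply: eq_bigr => k _; rewrite mxE mulr1.
Qed.

Lemma influx_ge0 (R : realType) (N : nat) (A : nat -> 'M[R]_N) (K : jet N)
    (t : nat) :
  (forall t, stochastic (A t)) -> 0 <= influx A K t.
Proof.
move=> hA; apply: sumr_ge0 => i _; apply: sumr_ge0 => j _.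
exact: (proj1 (hA t)).
Qed.

(** A trajectory that starts nonpositive on [K t0] and at most 1 elsewhere can
    grow on the jet [K] only through its influx. *)
Lemma trajectory_le_influx (R : realType) (N : nat) (A : nat -> 'M[R]_N)
    (K : jet N) (t0 : nat) (u : 'cV[R]_N) (n : nat) (i : 'I_N) :
  (forall t, stochastic (A t)) -> (forall j, u j 0 <= 1) ->
  (forall j, j \in K t0 -> u j 0 <= 0) ->
  i \in K (t0 + n)%N ->
  trajectory A t0 u n i 0 <= \sum_(t0 <= t < t0 + n) influx A K t.
Proof.
move=> hA u1 u0; elim: n i => [|n IHn] i.
  by rewrite addn0 big_geq//; apply: u0.
rewrite addnS => iK; rewrite big_nat_recr ?leq_addr//=.
apply: (le_trans (weighted_mean_le i (hA _) _ _ IHn)).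
- by apply: sumr_ge0 => t _; apply: influx_ge0.
- by move=> j; apply: trajectory_le1.
rewrite lerD2l /influx [leRHS](bigD1 i)//= lerDl.
apply: sumr_ge0 => k _; apply: sumr_ge0 => j _.
exact: (proj1 (hA _)).
Qed.

Lemma jet_flowE (R : realType) (N : nat) (A : nat -> 'M[R]_N) (J : jet N) :
  jet_flow A J (jet_compl J) =
  (\sum_(0 <= t <oo) (influx A J t + influx A (jet_compl J) t)%:E)%E.
Proof.
rewrite /jet_flow; congr (limn _); apply/funext => n.
apply: eq_bigr => t _; rewrite /influx /jet_compl.
by rewrite finset.setCK.
Qed.

Lemma jet_flow_tail (R : realType) (N : nat) (A : nat -> 'M[R]_N) (J : jet N)
    (e : R) :
  (forall t, stochastic (A t)) -> 0 < e ->
  (jet_flow A J (jet_compl J) < +oo)%E ->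
  exists t0, forall t1,
    \sum_(t0 <= t < t1) (influx A J t + influx A (jet_compl J) t) <= e.
Proof.
move=> hA e0; rewrite jet_flowE => fin.
set f := fun t => influx A J t + influx A (jet_compl J) t.
have f0 t : 0 <= f t by rewrite addr_ge0// influx_ge0.
have /fine_cvgP[finN /cvgr_dist_lt/(_ e e0) smallN] :=
  nneseries_tail_cvg fin (fun t _ => f0 t).
have [t0 _ /(_ t0 (leqnn t0)) [fin0 small0]] := filterI finN smallN.
exists t0 => t1; rewrite -lee_fin -sumEFin.
apply: (le_trans (nneseries_lim_ge _ _)) => [t _ _|]; first exact: f0.
rewrite -(fineK fin0) lee_fin ltW//.
by apply: le_lt_trans small0; rewrite /= sub0r normrN ler_norm.
Qed.

(** Along an ergodic chain the coordinates of every trajectory approach one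
    another: they converge to those of [L *m u], and [L] has identical rows. *)
Lemma ergodic_trajectory_consensus (R : realType) (N : nat)
    (A : nat -> 'M[R]_N) (t0 : nat) (u : 'cV[R]_N) (e : R) :
  ergodic A -> 0 < e ->
  exists n, forall i k,
    trajectory A t0 u n i 0 - trajectory A t0 u n k 0 < e.
Proof.
move=> /(_ t0) [L [cvgL rowL]] e0.
have cvgu i : (backward_prod A t0 t *m u) i 0 @[t --> \oo] --> (L *m u) i 0.
  rewrite [X in _ --> X]mxE; under eq_fun do rewrite mxE.
  apply: cvg_big => [|j _]; first exact: add_continuous.
  apply: cvgMr_tmp.
  exact: (cvg_comp _ _ cvgL (@coord_continuous _ _ _ i j L)).
have e2 : 0 < e / 2 by rewrite divr_gt0.
have nearL i : \forall t \near \oo,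
    `|(L *m u) i 0 - (backward_prod A t0 t *m u) i 0| < e / 2.
  exact: cvgr_dist_lt (cvgu i) _ e2.
have [T _ close] := filter_forall _ nearL.
exists T.+1 => i k; rewrite trajectory_backward_prod.
have cLu : (L *m u) i 0 = (L *m u) k 0.
  rewrite !mxE; apply: eq_bigr => j _; congr (_ * _).
  by have /rowP/(_ j) := rowL i k; rewrite !mxE.
have := close (t0 + T)%N (leq_addl _ _).
move=> near_lim; have := near_lim i; have := near_lim k.
rewrite cLu !ltr_norml => /andP[? ?] /andP[? ?]; lra.
Qed.

Theorem corollary1 (R : realType) (N : nat) (A : nat -> 'M[R]_N)
  (hA : forall t : nat, stochastic (A t)) :
  ergodic A -> infinite_jet_flow A.
Proof.
move=> ergA J properJ; apply/eqP; rewrite -leye_eq leNgt; apply/negP => fin.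
have q0 : 0 < 4^-1 :> R by rewrite invr_gt0.
have [t0 tail] := jet_flow_tail hA q0 fin.
pose x := trajectory A t0 (indicator_cv R (J t0)).
pose y := trajectory A t0 (indicator_cv R (~: J t0)%SET).
have ind1 (S : {set 'I_N}) j : indicator_cv R S j 0 <= 1.
  by rewrite mxE; case: (j \in S).
have xDy n i : x n i 0 + y n i 0 = 1.
  have -> : x n i 0 + y n i 0 = (x n + y n) i 0 by rewrite mxE.
  rewrite -trajectoryD; set u := _ + _.
  have -> : u = const_mx 1.
    apply/matrixP => k j; rewrite !mxE inE.
    by case: (k \in J t0); rewrite ?addr0 ?add0r.
  by rewrite trajectory_const1// mxE.
have influx_le (K : jet N) n :
    (forall t, influx A K t <= influx A J t + influx A (jet_compl J) t) ->
    \sum_(t0 <= t < t0 + n) influx A K t <= 4^-1.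
  by move=> le_flow; apply: le_trans (tail (t0 + n)%N); apply: ler_sum.
have x_small n k : k \notin J (t0 + n)%N -> x n k 0 <= 4^-1.
  move=> kJ; apply: (@le_trans _ _ _ _ _ _ (influx_le (jet_compl J) n _)).
    apply: trajectory_le_influx => // [j|]; last by rewrite inE.
    by rewrite inE mxE => /negbTE->.
  by move=> t; rewrite lerDr influx_ge0.
have y_small n i : i \in J (t0 + n)%N -> y n i 0 <= 4^-1.
  move=> iJ; apply: (@le_trans _ _ _ _ _ _ (influx_le J n _)).
    by apply: trajectory_le_influx => // j jJ; rewrite mxE inE jJ.
  by move=> t; rewrite lerDl influx_ge0.
have half0 : 0 < 2^-1 :> R by rewrite invr_gt0.
have [n consensus] :=
  ergodic_trajectory_consensus t0 (indicator_cv R (J t0)) ergA half0.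
have [/finset.set0Pn[i iJ] /properP[_ [k _ kJ]]] := properJ (t0 + n)%N.
have := consensus i k; rewrite -/(x n).
have := x_small n k kJ; have := y_small n i iJ; have := xDy n i.
lra.
Qed.
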